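(* Let $W=(W_i,w_i)_{i\in I}$ and $V=(V_i,v_i)_{i\in I}$ be fusion frames for a Hilbert space $\mathcal H$. Then $\mathcal M_\otimes^{(W,V)}$ and $\mathcal O_\otimes^{(W,V)}$ are bounded operators; moreover, $$\mathcal O_\otimes^{(W,V)}\,\mathcal M_\otimes^{(W,V)}=\mathrm{id}_{\mathcal B(\mathcal H)}.$$
   Context: $\mathcal B(X,Y)$ denotes the bounded linear operators between Hilbert spaces, $\mathcal B(X)=\mathcal B(X,X)$; $\pi_U$ is the orthogonal projection onto a closed subspace $U$. A fusion frame for $\mathcal H$ is a family $W=(W_i,w_i)_{i\in I}$ of closed subspaces $W_i\subseteq\mathcal H$ and weights $w_i>0$ for which there are $0<A_W\le B_W<\infty$ with $A_W\|f\|^2\le\sum_iw_i^2\|\pi_{W_i}f\|^2\le B_W\|f\|^2$ for all $f\in\mathcal H$. $\left(\sum\bigoplus W_i\right)_{\ell^2}$ is the Hilbert space of $\{f_i\}_{i\in I}$ with $f_i\in W_i$, $\sum\|f_i\|^2<\infty$. The synthesis operator is $T_W\{f_i\}=\sum_iw_if_i$ with adjoint $T_W^*f=\{w_i\pi_{W_i}f\}_i$; the fusion frame operator $S_W=T_WT_W^*$ is bounded, positive and invertible. Tensor product of operators: $(S\otimes T)(O):=SOT^*$. Define $\mathcal M_\otimes^{(W,V)}=(T_W^*\otimes T_V^* )\circ(S_W^{-1/2}\otimes S_V^{-1/2})$, i.e. $\mathcal M_\otimes^{(W,V)}:\mathcal B(\mathcal H)\to\mathcal B\left(\left(\sum\bigoplus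 V_i\right)_{\ell^2},\left(\sum\bigoplus W_i\right)_{\ell^2}\right)$, $\mathcal M_\otimes^{(W,V)}(O)=T_W^*S_W^{-1/2}OS_V^{-1/2}T_V$; and $\mathcal O_\otimes^{(W,V)}=(S_W^{-1/2}\otimes S_V^{-1/2})\circ(T_W\otimes T_V)$, i.e. $\mathcal O_\otimes^{(W,V)}:\mathcal B\left(\left(\sum\bigoplus V_i\right)_{\ell^2},\left(\sum\bigoplus W_i\right)_{\ell^2}\right)\to\mathcal B(\mathcal H)$, $\mathcal O_\otimes^{(W,V)}(M)=S_W^{-1/2}T_WMT_V^*S_V^{-1/2}$. *)

(* Defs.v *)
From HB Require Import structures.
From mathcomp Require Import all_boot all_order all_algebra.
From mathcomp Require Import finmap complex ring.
From mathcomp Require Import all_classical all_reals.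
From mathcomp Require Import topology normedtype ereal esum.
From mathcomp Require Import showcase.summability.

Set Implicit Arguments.
Unset Strict Implicit.
Unset Printing Implicit Defensive.

Import Order.TTheory GRing.Theory Num.Theory.
Import numFieldNormedType.Exports.

Local Open Scope classical_set_scope.
Local Open Scope ring_scope.

Inductive scalar_kind := RealScalars | ComplexScalars.

Definition scalar (R : realType) (k : scalar_kind) : numFieldType :=
  match k with RealScalars => R | ComplexScalars => R[i] end.

Definition sconj (R : realType) (k : scalar_kind) :
    scalar R k -> scalar R k :=
  match k with
  | RealScalars => idfun
  | ComplexScalars => fun z : R[i] => z^*
  end.

Definition of_real (R : realType) (k : scalar_kind) : R -> scalar R k :=
  match k with
  | RealScalars => idfun
  | ComplexScalars => fun x : R => x%:C%C
  end.

Definition sreal (R : realType) (k : scalar_kind) : scalar R k -> R :=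
  match k with
  | RealScalars => idfun
  | ComplexScalars => fun z : R[i] => complex.Re z
  end.
Arguments of_real {R} k x.
Arguments sreal {R k} z.

(** The norm of a [normedModType K] takes its values in [K]; [rnorm] is the
    same norm with values in the reals. *)
Definition rnorm (R : realType) (k : scalar_kind)
  (X : normedModType (scalar R k)) (x : X) : R := sreal `|x|.

Section scalar_facts.
Variables (R : realType) (k : scalar_kind).
Implicit Types (a b : R) (z : scalar R k).

Lemma of_realD a b : of_real k (a + b) = of_real k a + of_real k b.
Proof. by case: k => //=; rewrite rmorphD. Qed.

Lemma of_realM a b : of_real k (a * b) = of_real k a * of_real k b.
Proof. by case: k => //=; rewrite rmorphM. Qed.

Lemma of_real0 : of_real k (0 : R) = 0.
Proof. by case: k => //=; rewrite rmorph0. Qed.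

Lemma ler_of_real a b : (of_real k a <= of_real k b) = (a <= b).
Proof. by case: k => //=; rewrite lecR. Qed.

Lemma of_realK a : sreal (of_real k a) = a.
Proof. by case: k. Qed.

Lemma srealK z : z \is Num.real -> of_real k (sreal z) = z.
Proof.
by case: k z => //= -[a b]; rewrite complex_real => /eqP /= ->.
Qed.

Lemma rnormE (X : normedModType (scalar R k)) (x : X) :
  of_real k (rnorm x) = `|x|.
Proof. by rewrite /rnorm srealK// normr_real. Qed.

Lemma rnorm_ge0 (X : normedModType (scalar R k)) (x : X) : 0 <= rnorm x.
Proof. by rewrite -(ler_of_real) of_real0 rnormE. Qed.

Lemma rnorm0 (X : normedModType (scalar R k)) : rnorm (0 : X) = 0.
Proof. by rewrite /rnorm normr0 -of_real0 of_realK. Qed.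

Lemma rnorm_eq0 (X : normedModType (scalar R k)) (x : X) :
  rnorm x = 0 -> x = 0.
Proof. by move=> x0; apply/normr0_eq0; rewrite -rnormE x0 of_real0. Qed.

Lemma ler_rnormD (X : normedModType (scalar R k)) (x y : X) :
  rnorm (x + y) <= rnorm x + rnorm y.
Proof. by rewrite -ler_of_real of_realD !rnormE ler_normD. Qed.

Lemma of_real_inj : injective (@of_real R k).
Proof. by move=> a b /(congr1 sreal); rewrite !of_realK. Qed.

Lemma rnormZ (X : normedModType (scalar R k)) z (x : X) :
  rnorm (z *: x) = sreal `|z| * rnorm x.
Proof.
by apply: of_real_inj; rewrite of_realM srealK ?normr_real// !rnormE normrZ.
Qed.

End scalar_facts.

Record hilbertType (R : realType) (k : scalar_kind) := HilbertType {
  hilbert_sort :> completeNormedModType (scalar R k);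
  inner : {dot hilbert_sort for @sconj R k};
  innerE : forall x, inner x x = `|x| ^+ 2 }.

Definition bounded_linear (K : numFieldType) (X Y : normedModType K)
    (f : X -> Y) : Prop :=
  linear f /\ exists C : K, forall x, `|f x| <= C * `|x|.

Definition bounded_linear_pred (K : numFieldType) (X Y : normedModType K) :
  {pred X -> Y} := [pred f | `[< bounded_linear f >]].

Section bounded_operator_lmodule.
Variables (K : numFieldType) (X Y : normedModType K).

Lemma bounded_linear_submod : submod_closed (@bounded_linear_pred K X Y).
Proof.
split.
  apply/asboolP; split; last by exists 0 => x; rewrite /= normr0 mul0r.
  by move=> a x y; rewrite /= scaler0 addr0.
move=> a f g /asboolP[lf [C fC]] /asboolP[lg [D gD]]; apply/asboolP; split.
  move=> b x y; change (a *: f (b *: x + y) + g (b *: x + y) =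
    b *: (a *: f x + g x) + (a *: f y + g y)).
  by rewrite lf lg !scalerDr !scalerA mulrC addrACA.
exists (`|a| * C + D) => x; change (`|a *: f x + g x| <= (`|a| * C + D) * `|x|).
apply: (le_trans (ler_normD _ _)).
by rewrite mulrDl lerD// normrZ -mulrA ler_wpM2l.
Qed.

HB.instance Definition _ := GRing.isSubmodClosed.Build K (X -> Y)
  (@bounded_linear_pred K X Y) bounded_linear_submod.

Record bounded_operator := BoundedOperator {
  bounded_operator_fun :> X -> Y;
  bounded_operatorP : bounded_operator_fun \in @bounded_linear_pred K X Y }.

HB.instance Definition _ := [isSub for bounded_operator_fun].
HB.instance Definition _ := [Choice of bounded_operator by <:].
HB.instance Definition _ :=
  [SubChoice_isSubLmodule of bounded_operator by <:].

End bounded_operator_lmodule.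

Notation "''B' ( X , Y )" := (bounded_operator X Y)
  (at level 8, format "''B' ( X ,  Y )") : type_scope.

Section bounded_operator_comp.
Variables (K : numFieldType) (X Y Z : normedModType K).

Lemma comp_bounded_linear (S : 'B(Y, Z)) (T : 'B(X, Y)) :
  S \o T \in @bounded_linear_pred K X Z.
Proof.
have /asboolP[lS [C SC]] := bounded_operatorP S.
have /asboolP[lT [D TD]] := bounded_operatorP T.
apply/asboolP; split; first by move=> a x y /=; rewrite lT lS.
have C0 : `|C| \is Num.real by exact: normr_real.
exists (`|C| * D) => x /=.
have CC y : `|S y| <= `|C| * `|y|.
  rewrite (le_trans (SC y))//.
  have [y0|y0] := eqVneq `|y| 0; first by rewrite y0 !mulr0.
  have yp : 0 < `|y| by rewrite lt_def y0 normr_ge0.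
  have : 0 <= C.
    by rewrite -(pmulr_lge0 _ yp) (le_trans _ (SC y)).
  by move=> /ger0_norm ->.
by rewrite (le_trans (CC _))// -mulrA ler_wpM2l.
Qed.

Definition bcomp (S : 'B(Y, Z)) (T : 'B(X, Y)) : 'B(X, Z) :=
  BoundedOperator (comp_bounded_linear S T).

End bounded_operator_comp.

Notation "S \ob T" := (bcomp S T)
  (at level 50, left associativity) : ring_scope.

Lemma id_bounded_linear (K : numFieldType) (X : normedModType K) :
  idfun \in @bounded_linear_pred K X X.
Proof. by apply/asboolP; split=> //; exists 1 => x; rewrite mul1r. Qed.

Definition bid (K : numFieldType) (X : normedModType K) : 'B(X, X) :=
  BoundedOperator (id_bounded_linear X).

Section operator_norm.
Variables (R : realType) (k : scalar_kind) (X Y : normedModType (scalar R k)).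
Implicit Types S T : 'B(X, Y).

Definition op_bounds T : set R :=
  [set c | 0 <= c /\ forall x, rnorm (T x) <= c * rnorm x].

Definition opnorm T : R := inf (op_bounds T).

Lemma op_bounds_has_inf T : has_inf (op_bounds T).
Proof.
split; last by exists 0 => c [].
have /asboolP[lT [C TC]] := bounded_operatorP T.
exists (sreal `|C|); split.
  by rewrite -(ler_of_real k) of_real0 srealK ?normr_real.
move=> x; rewrite -(ler_of_real k) of_realM srealK ?normr_real// !rnormE.
rewrite (le_trans (TC x))//.
have [->|x0] := eqVneq `|x| 0; first by rewrite !mulr0.
have xp : 0 < `|x| by rewrite lt_def x0 normr_ge0.
have : 0 <= C by rewrite -(pmulr_lge0 _ xp) (le_trans _ (TC x)).
by move=> /ger0_norm ->.
Qed.

Lemma opnorm_le T c :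
  0 <= c -> (forall x, rnorm (T x) <= c * rnorm x) -> opnorm T <= c.
Proof. by move=> c0 Tc; apply: ge_inf; [exact: (op_bounds_has_inf T).2|]. Qed.

Lemma opnorm_ge0 T : 0 <= opnorm T.
Proof. by apply: lb_le_inf; [exact: (op_bounds_has_inf T).1|move=> c []]. Qed.

Lemma opnormP T x : rnorm (T x) <= opnorm T * rnorm x.
Proof.
have [x0|x0] := eqVneq (rnorm x) 0.
  have [c [_ /(_ x)]] := (op_bounds_has_inf T).1.
  by rewrite x0 !mulr0.
have xp : 0 < rnorm x by rewrite lt_def x0 rnorm_ge0.
rewrite -ler_pdivrMr//; apply: lb_le_inf.
  exact: (op_bounds_has_inf T).1.
by move=> c [_ Tc]; rewrite ler_pdivrMr.
Qed.

Let norm T : scalar R k := of_real k (opnorm T).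

Let ler_normD S T : norm (S + T) <= norm S + norm T.
Proof.
rewrite /norm -of_realD ler_of_real.
apply: opnorm_le => [|x]; first by rewrite addr_ge0 ?opnorm_ge0.
by rewrite (le_trans (ler_rnormD _ _))// mulrDl lerD ?opnormP.
Qed.

Let opnormZ_le (a : scalar R k) T : opnorm (a *: T) <= sreal `|a| * opnorm T.
Proof.
have a0 : 0 <= sreal `|a|.
  by rewrite -(ler_of_real k) of_real0 srealK ?normr_real.
apply: opnorm_le => [|x]; first by rewrite mulr_ge0 ?opnorm_ge0.
change (rnorm (a *: T x) <= sreal `|a| * opnorm T * rnorm x).
by rewrite rnormZ -mulrA ler_wpM2l ?opnormP.
Qed.

Let normrZ (a : scalar R k) T : norm (a *: T) = `|a| * norm T.
Proof.
have -> : `|a| = of_real k (sreal `|a|) by rewrite srealK ?normr_real.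
rewrite /norm -of_realM; congr of_real.
apply/eqP; rewrite eq_le opnormZ_le/=.
have [->|a0] := eqVneq a 0.
  by rewrite normr0 -(of_real0 R k) of_realK mul0r opnorm_ge0.
have ap : 0 < sreal `|a|.
  rewrite lt_def -[X in X != _](of_realK k) -(inj_eq (@of_real_inj R k)).
  rewrite of_realK srealK ?normr_real// of_real0 normr_eq0 a0/=.
  by rewrite -(ler_of_real k) of_real0 srealK ?normr_real.
rewrite -ler_pdivlMl//.
have {1}-> : T = a^-1 *: (a *: T) by rewrite scalerA mulVf// scale1r.
rewrite (le_trans (opnormZ_le _ _))//.
suff -> : sreal `|a^-1| = (sreal `|a|)^-1 by [].
apply: (mulfI (lt0r_neq0 ap)); rewrite divff ?gt_eqF//.
apply: (@of_real_inj R k); rewrite of_realM !srealK ?normr_real//.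
rewrite -normrM divff// normr1.
by case: (k).
Qed.

Let normr0_eq0 T : norm T = 0 -> T = 0.
Proof.
rewrite /norm -(of_real0 R k) => /of_real_inj T0.
apply/val_inj/funext => x; apply: rnorm_eq0; apply/eqP.
by rewrite eq_le rnorm_ge0 andbT (le_trans (opnormP _ _))// T0 mul0r.
Qed.

HB.instance Definition _ := Lmodule_isNormed.Build (scalar R k) 'B(X, Y)
  ler_normD normrZ normr0_eq0.

End operator_norm.

Section hilbert_operators.
Variables (R : realType) (k : scalar_kind) (H : hilbertType R k).

(** Self-adjointness is automatic over the complex numbers only. *)
Definition positive_op (T : 'B(H, H)) : Prop :=
  (forall x y, inner H (T x) y = inner H x (T y)) /\
  (forall x, 0 <= inner H (T x) x).

(** [op_sqrt T] is the unique positive square root of a positive [T], and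
    [op_inv T] the inverse of an invertible [T]; both are [0] if there is no
    such operator. *)
Definition op_sqrt (T : 'B(H, H)) : 'B(H, H) :=
  xget 0 [set Q | positive_op Q /\ Q \ob Q = T].

Definition op_inv (T : 'B(H, H)) : 'B(H, H) :=
  xget 0 [set Q | Q \ob T = bid H /\ T \ob Q = bid H].

Record closed_subspace := ClosedSubspace {
  subspace_set : set H;
  subspace0 : subspace_set 0;
  subspaceD : forall x y,
    subspace_set x -> subspace_set y -> subspace_set (x + y);
  subspaceZ : forall (a : scalar R k) x, subspace_set x -> subspace_set (a *: x);
  subspace_closed : closed subspace_set }.

Definition orth_proj (U : closed_subspace) (x : H) : H :=
  xget 0 [set u | subspace_set U u /\
    forall v, subspace_set U v -> inner H (x - u) v = 0].

End hilbert_operators.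

Section l2_sum.
Variables (R : realType) (k : scalar_kind) (H : hilbertType R k).
Variables (I : choiceType) (W : I -> closed_subspace H).
Implicit Types f g : I -> H.

Definition sqnorm_sum (f : I -> H) : \bar R :=
  (\esum_(i in [set: I]) (rnorm (f i) ^+ 2)%:E)%E.

Definition l2_pred : {pred I -> H} :=
  [pred f | `[< (forall i, subspace_set (W i) (f i)) /\ (sqnorm_sum f < +oo)%E >]].

Lemma sqnorm_sum_ge0 f : (0 <= sqnorm_sum f)%E.
Proof. by apply: esum_ge0 => i _; rewrite lee_fin sqr_ge0. Qed.

Lemma esumZ_le (c : R) (a : I -> R) : 0 <= c -> (forall i, 0 <= a i) ->
  (\esum_(i in [set: I]) (c * a i)%:E <=
   c%:E * \esum_(i in [set: I]) (a i)%:E)%E.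
Proof.
move=> c0 a0; apply: ub_ereal_sup => _ [A [finA _] <-].
have -> : (\sum_(x \in A) (c * a x)%:E = c%:E * \sum_(x \in A) (a x)%:E)%E.
  rewrite !fsbig_finite//= ge0_sume_distrr//.
  by move=> i _; rewrite lee_fin.
rewrite lee_wpmul2l ?lee_fin//; apply: ereal_sup_ubound.
by exists A.
Qed.

Lemma sqnorm_sumD_le f g (s t : R) : 0 < s -> 0 < t ->
  (sqnorm_sum (f + g)%R <=
   ((s + t) / s)%:E * sqnorm_sum f + ((s + t) / t)%:E * sqnorm_sum g)%E.
Proof.
move=> s0 t0; have st0 : 0 < s + t by rewrite addr_gt0.
have cs : 0 <= (s + t) / s by rewrite divr_ge0 ?ltW.
have ct : 0 <= (s + t) / t by rewrite divr_ge0 ?ltW.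
apply: (@le_trans _ _ (\esum_(i in [set: I])
   (((s + t) / s * rnorm (f i) ^+ 2)%:E +
    ((s + t) / t * rnorm (g i) ^+ 2)%:E))%E).
  apply: le_esum => i _; rewrite -EFinD lee_fin.
  apply: (@le_trans _ _ ((rnorm (f i) + rnorm (g i)) ^+ 2)).
    by rewrite lerXn2r ?nnegrE ?rnorm_ge0 ?addr_ge0 ?rnorm_ge0 ?ler_rnormD.
  move: (rnorm (f i)) (rnorm (g i)) => a b; rewrite -subr_ge0.
  suff -> : (s + t) / s * a ^+ 2 + (s + t) / t * b ^+ 2 - (a + b) ^+ 2 =
    (t * a - s * b) ^+ 2 / (s * t) by rewrite divr_ge0 ?sqr_ge0 ?mulr_ge0 ?ltW.
  have s1 : s != 0 by rewrite gt_eqF.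
  have t1 : t != 0 by rewrite gt_eqF.
  by field; rewrite s1 t1.
rewrite esumD; last 2 first.
- by move=> i _; rewrite lee_fin mulr_ge0 ?sqr_ge0.
- by move=> i _; rewrite lee_fin mulr_ge0 ?sqr_ge0.
by apply: leeD; apply: esumZ_le => // i; exact: sqr_ge0.
Qed.

Lemma sqnorm_sumZ_le (a : scalar R k) f :
  (sqnorm_sum (a *: f)%R <= ((sreal `|a|) ^+ 2)%:E * sqnorm_sum f)%E.
Proof.
rewrite /sqnorm_sum.
under eq_esum => i _ do rewrite rnormZ exprMn.
by apply: esumZ_le => [|i]; exact: sqr_ge0.
Qed.

Lemma sqnorm_sum_fin f : (sqnorm_sum f < +oo)%E -> (sqnorm_sum f \is a fin_num).
Proof. by move=> foo; rewrite ge0_fin_numE ?sqnorm_sum_ge0. Qed.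

Lemma l2_submod : submod_closed l2_pred.
Proof.
split.
  apply/asboolP; split=> [i|]; first exact: subspace0.
  rewrite /sqnorm_sum esum1 ?ltry// => i _.
  by rewrite (_ : _ i = 0)// rnorm0 expr0n.
move=> a f g /asboolP[Wf foo] /asboolP[Wg goo]; apply/asboolP; split=> [i|].
  by apply: subspaceD; [exact: subspaceZ|].
apply: le_lt_trans (@sqnorm_sumD_le _ _ 1 1 ltr01 ltr01) _.
have zoo : (sqnorm_sum (a *: f)%R < +oo)%E.
  apply: le_lt_trans (sqnorm_sumZ_le _ _) _.
  by rewrite -(fineK (sqnorm_sum_fin foo)) -EFinM ltry.
rewrite -(fineK (sqnorm_sum_fin zoo)) -(fineK (sqnorm_sum_fin goo)).
by rewrite -!EFinM -EFinD ltry.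
Qed.

HB.instance Definition _ := GRing.isSubmodClosed.Build (scalar R k) (I -> H)
  l2_pred l2_submod.

Record l2_sum := L2Sum {
  l2_fun :> I -> H;
  l2_funP : l2_fun \in l2_pred }.

HB.instance Definition _ := [isSub for l2_fun].
HB.instance Definition _ := [Choice of l2_sum by <:].
HB.instance Definition _ := [SubChoice_isSubLmodule of l2_sum by <:].

Definition l2_norm (f : l2_sum) : R := Num.sqrt (fine (sqnorm_sum f)).

Let norm (f : l2_sum) : scalar R k := of_real k (l2_norm f).

Lemma l2_sum_fin (f : l2_sum) : sqnorm_sum f \is a fin_num.
Proof. by have /asboolP[_ /sqnorm_sum_fin] := l2_funP f. Qed.

Lemma l2_normE (f : l2_sum) : sqnorm_sum f = (l2_norm f ^+ 2)%:E.
Proof. by rewrite sqr_sqrtr ?fineK ?l2_sum_fin ?fine_ge0 ?sqnorm_sum_ge0. Qed.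

Lemma l2_norm_ge0 (f : l2_sum) : 0 <= l2_norm f.
Proof. exact: sqrtr_ge0. Qed.

Let ler_normD (f g : l2_sum) : norm (f + g) <= norm f + norm g.
Proof.
rewrite /norm -of_realD ler_of_real; apply/ler_addgt0Pr => e e0.
have e2 : 0 < e / 2 by rewrite divr_gt0.
set s := l2_norm f + e / 2; set t := l2_norm g + e / 2.
have s0 : 0 < s by rewrite ltr_wpDl ?l2_norm_ge0.
have t0 : 0 < t by rewrite ltr_wpDl ?l2_norm_ge0.
have -> : l2_norm f + l2_norm g + e = s + t.
  by rewrite addrACA -splitr.
have st0 : 0 <= s + t by rewrite addr_ge0// ltW.
rewrite -(@ler_pXn2r _ 2)// ?nnegrE ?l2_norm_ge0//.
rewrite -lee_fin -l2_normE (le_trans (sqnorm_sumD_le _ _ s0 t0))//.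
rewrite !l2_normE -!EFinM -EFinD lee_fin expr2 [leRHS]mulrDr.
have aux (x y : R) : 0 <= x -> x <= y -> 0 < y ->
    (s + t) / y * x ^+ 2 <= (s + t) * y.
  move=> x0 xy y0; rewrite -mulrA ler_wpM2l//.
  rewrite ler_pdivrMl// -expr2 lerXn2r ?nnegrE//; exact: ltW.
by rewrite lerD// aux ?l2_norm_ge0 ?lerDl ?ltW.
Qed.

Let l2_normZ_le (a : scalar R k) (f : l2_sum) :
  l2_norm (a *: f) <= sreal `|a| * l2_norm f.
Proof.
have a0 : 0 <= sreal `|a|.
  by rewrite -(ler_of_real k) of_real0 srealK ?normr_real.
rewrite -(@ler_pXn2r _ 2)// ?nnegrE ?mulr_ge0 ?l2_norm_ge0//.
rewrite -lee_fin -l2_normE (le_trans (sqnorm_sumZ_le _ _))//.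
by rewrite l2_normE -EFinM exprMn.
Qed.

Let normrZ (a : scalar R k) (f : l2_sum) : norm (a *: f) = `|a| * norm f.
Proof.
have -> : `|a| = of_real k (sreal `|a|) by rewrite srealK ?normr_real.
rewrite /norm -of_realM; congr of_real.
apply/eqP; rewrite eq_le l2_normZ_le/=.
have [->|a0] := eqVneq a 0.
  by rewrite normr0 -(of_real0 R k) of_realK mul0r l2_norm_ge0.
have ap : 0 < sreal `|a|.
  rewrite lt_def -(inj_eq (@of_real_inj R k)).
  rewrite srealK ?normr_real// of_real0 normr_eq0 a0/=.
  by rewrite -(ler_of_real k) of_real0 srealK ?normr_real.
rewrite -ler_pdivlMl//.
have {1}-> : f = a^-1 *: (a *: f) by rewrite scalerA mulVf// scale1r.
rewrite (le_trans (l2_normZ_le _ _))//.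
suff -> : sreal `|a^-1| = (sreal `|a|)^-1 by [].
apply: (mulfI (lt0r_neq0 ap)); rewrite divff ?gt_eqF//.
apply: (@of_real_inj R k); rewrite of_realM !srealK ?normr_real//.
rewrite -normrM divff// normr1.
by case: (k).
Qed.

Let normr0_eq0 (f : l2_sum) : norm f = 0 -> f = 0.
Proof.
rewrite /norm -(of_real0 R k) => /of_real_inj f0.
apply/val_inj/funext => i; apply: rnorm_eq0; apply/eqP.
rewrite -sqrf_eq0 eq_le sqr_ge0 andbT -lee_fin.
apply: (@le_trans _ _ (sqnorm_sum f)); last by rewrite l2_normE f0 expr0n.
rewrite -(@esum_set1 _ _ i (fun i => (rnorm (f i) ^+ 2)%:E)) ?lee_fin ?sqr_ge0//.
apply: esum_ge; exists [set i].
  by split.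
by rewrite esum_set1 ?lee_fin ?sqr_ge0// fsbig_set1.
Qed.

HB.instance Definition _ := Lmodule_isNormed.Build (scalar R k) l2_sum
  ler_normD normrZ normr0_eq0.

End l2_sum.

Record fusion_frame (R : realType) (k : scalar_kind) (H : hilbertType R k)
    (I : choiceType) := FusionFrame {
  ff_space :> I -> closed_subspace H;
  ff_weight : I -> R;
  ff_weight_gt0 : forall i, 0 < ff_weight i;
  ff_bounds : exists A B : R, [/\ 0 < A, A <= B & forall f : H,
    ((A * rnorm f ^+ 2)%:E <=
      \esum_(i in [set: I])
        (ff_weight i ^+ 2 * rnorm (orth_proj (ff_space i) f) ^+ 2)%:E <=
      (B * rnorm f ^+ 2)%:E)%E] }.

Section fusion_frame_operators.
Variables (R : realType) (k : scalar_kind) (H : hilbertType R k).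
Variables (I : choiceType).
Implicit Types W V : fusion_frame H I.

(** [insubd 0 F] is the element of the subtype with underlying function [F].
    By the upper fusion frame bound, the functions below do belong to the
    subtypes, so that the default value [0] is not used. The sum is the
    unconditional one: the limit over the net of finite subsets of [I]. *)
Definition synthesis W : 'B(l2_sum W, H) :=
  insubd (0 : 'B(l2_sum W, H)) (fun f : l2_sum W =>
    sum (fun i => of_real k (ff_weight W i) *: f i)).

Definition analysis W : 'B(H, l2_sum W) :=
  insubd (0 : 'B(H, l2_sum W)) (fun x : H =>
    insubd (0 : l2_sum W) (fun i => of_real k (ff_weight W i) *: orth_proj (W i) x)).

Definition frame_operator W : 'B(H, H) := synthesis W \ob analysis W.

Definition frame_inv_sqrt W : 'B(H, H) := op_inv (op_sqrt (frame_operator W)).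

Definition M_tensor W V (O : 'B(H, H)) : 'B(l2_sum V, l2_sum W) :=
  analysis W \ob frame_inv_sqrt W \ob O \ob frame_inv_sqrt V \ob synthesis V.

Definition O_tensor W V (M : 'B(l2_sum V, l2_sum W)) : 'B(H, H) :=
  frame_inv_sqrt W \ob synthesis W \ob M \ob analysis V \ob frame_inv_sqrt V.

End fusion_frame_operators.

Arguments M_tensor {R k H I} W V O.
Arguments O_tensor {R k H I} W V M.

(* Main.v *)
From HB Require Import structures.
From mathcomp Require Import all_boot all_order all_algebra.
From mathcomp Require Import finmap complex ring lra.
From mathcomp Require Import all_classical all_reals topology normedtype.
From mathcomp Require Import ereal sequences esum.
From mathcomp Require Import showcase.summability.
Require Import Defs.

(** With [S = T T^*] the fusion frame operator, the composite of the two maps is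
    [O |-> S_W^(-1/2) S_W S_W^(-1/2) O S_V^(-1/2) S_V S_V^(-1/2)], so the
    identity amounts to [S^(-1/2) S S^(-1/2) = 1] for each frame; and both maps
    have the shape [O |-> A O B], whence they are linear and bounded by
    [||A|| ||B||] ([sandwich_bounded_linear]).

    The substance is that all the operators involved exist: the analysis and
    synthesis operators, the square root and the inverse are defined by choosing
    an object that has the required property, with a default value if there is
    none. Most of the work is done with the real inner product
    [rip x y = Re <x, y>], which treats real and complex scalars alike; it loses
    nothing, because [<x, y>] is determined by the numbers [Re <a x, y>].

    - Orthogonal projections ([exists_orth_proj]) come from completeness and the
      parallelogram identity, applied to nearly closest points.
    - The upper frame bound [B] gives [||sum_A w_i f_i||^2 <= B sum_A ||f_i||^2]
      for finite [A] ([rnorm_synthesis_fset]): the finite sums of a synthesis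
      form a Cauchy net, and synthesis and analysis are bounded. Then
      [<S x, y>] is the limit of [sum_A w_i^2 <p_i x, p_i y>], so [S] is
      symmetric and bounded below by the lower frame bound.
    - Let [S] be symmetric with [<S x, x> >= a ||x||^2], [a > 0]. For a suitable
      [t > 0] the operator [T = 1 - t S] has norm at most some [c < 1]
      ([coercive_near_identity]). Neumann's equation [Y = 1 + T Y] then yields
      the inverse of [S], and the equation [Y = (T + Y^2) / 2] yields its square
      root [t^(-1/2) (1 - Y)]; both are solved by Banach's fixed point theorem
      in the space of bounded operators, the second on the ball of radius [c].
      Whichever square root [P] of [S] is chosen, it is inverted by
      [P S^(-1) = S^(-1) P], and [P^(-1) S P^(-1) = P^(-1) P P P^(-1) = 1]
      ([inv_sqrt_sandwich]). *)

Set Implicit Arguments.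
Unset Strict Implicit.
Unset Printing Implicit Defensive.

Import Order.TTheory GRing.Theory Num.Theory.
Import numFieldNormedType.Exports.

Local Open Scope classical_set_scope.
Local Open Scope ring_scope.

(** * Real parts of scalars and real-valued norms *)

Section real_parts.
Variables (R : realType) (k : scalar_kind).
Implicit Types (a : R) (z u v : scalar R k).

Lemma srealD u v : sreal (u + v) = sreal u + sreal v.
Proof. by case: k u v => //= -[a b] [c d]. Qed.

Lemma sreal0 : sreal (0 : scalar R k) = 0.
Proof. by case: k. Qed.

Lemma srealN u : sreal (- u) = - sreal u.
Proof. by case: k u => //= -[a b]. Qed.

Lemma sreal_of_realM a z : sreal (of_real k a * z) = a * sreal z.
Proof. by case: k z => //= -[b c] /=; rewrite mul0r subr0. Qed.

Lemma sreal_conj z : sreal (sconj z) = sreal z.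
Proof. by case: k z => //= -[b c]. Qed.

Lemma sconjK : involutive (@sconj R k).
Proof. by case: k => //= z; rewrite conjCK. Qed.

(** A scalar is determined by the real parts of its multiples: the multiple
    by ['i] has the opposite of the imaginary part as its real part. *)
Lemma sreal_mul_inj u v :
  (forall a : scalar R k, sreal (a * u) = sreal (a * v)) -> u = v.
Proof.
case: k u v => /= [u v /(_ 1)|[a b] [c d] uv]; first by rewrite !mul1r.
have := uv 1; rewrite !mul1r /= => ->.
by have /= := uv 'i%C; rewrite !mul0r !mul1r !sub0r => /oppr_inj ->.
Qed.

(** A scalar that is its own conjugate is real, hence equal to its real part. *)
Lemma sreal_ge0 z : sconj z = z -> 0 <= sreal z -> 0 <= z.
Proof.
case: k z => //= -[a b] /= /eqP; rewrite eq_complex /= => /andP[_ /eqP bb] a0.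
rewrite lecE /= a0 andbT.
by apply/eqP; lra.
Qed.

Lemma gt0_of_real z : 0 < z -> exists2 e : R, 0 < e & z = of_real k e.
Proof.
move=> z0; exists (sreal z); last by rewrite srealK// gtr0_real.
move: z0; case: k z => //= -[a b].
by rewrite ltcE => /andP[].
Qed.

Lemma ltr_of_real (a b : R) : (of_real k a < of_real k b) = (a < b).
Proof. by case: k => //=; rewrite ltcR. Qed.

Lemma of_real1 : of_real k (1 : R) = 1.
Proof. by case: k. Qed.

Lemma sreal_norm_of_real a : sreal `|of_real k a| = `|a|.
Proof.
case: k => [//|]; change (complex.Re `|a%:C%C : R[i]| = `|a|).
by rewrite normc_def /= expr0n addr0 sqrtr_sqr.
Qed.

End real_parts.

Section rnorm.
Variables (R : realType) (k : scalar_kind) (X : normedModType (scalar R k)).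
Implicit Types (x y : X).

Lemma rnormN x : rnorm (- x) = rnorm x.
Proof. by rewrite /rnorm normrN. Qed.

Lemma rnormB x y : rnorm (x - y) = rnorm (y - x).
Proof. by rewrite -rnormN opprB. Qed.

Lemma rnorm_of_realZ (a : R) x : rnorm (of_real k a *: x) = `|a| * rnorm x.
Proof. by rewrite rnormZ sreal_norm_of_real. Qed.

Lemma scaler_half x : of_real k 2^-1 *: (x + x) = x.
Proof.
rewrite scalerDr -scalerDl -of_realD.
by rewrite (_ : 2^-1 + 2^-1 = 1) ?of_real1 ?scale1r//; field.
Qed.

Lemma ler_rnormB x y z : rnorm (x - z) <= rnorm (x - y) + rnorm (y - z).
Proof. by rewrite -[x - z](subrKA y) ler_rnormD. Qed.

(** The radii of balls in [X] are positive elements of the base field, and these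
    are real. *)
Lemma cvg_rnormP (T : Type) (F : set_system T) (FF : Filter F) (f : T -> X) l :
  f x @[x --> F] --> l <->
  (forall e : R, 0 < e -> \forall x \near F, rnorm (l - f x) < e).
Proof.
split=> [/cvgrPdist_lt fl e e0|fl]; last first.
  apply/cvgrPdist_lt => z /gt0_of_real[e e0 ->].
  by apply: filterS (fl e e0) => x; rewrite -rnormE ltr_of_real.
have e0' : 0 < of_real k e by rewrite -(of_real0 R k) ltr_of_real.
by apply: filterS (fl _ e0') => x; rewrite -rnormE ltr_of_real.
Qed.

End rnorm.

(** * The real inner product *)

Section real_inner.
Variables (R : realType) (k : scalar_kind) (H : hilbertType R k).
Implicit Types (x y z : H).

Definition rip x y : R := sreal (inner H x y).

Lemma innerC x y : inner H x y = sconj (inner H y x).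
Proof. by have := @hermitian_subproof _ _ _ _ (inner H) x y; rewrite mul1r. Qed.

Lemma innerDl x y z : inner H (x + y) z = inner H x z + inner H y z.
Proof. exact: linearDl. Qed.

Lemma innerZl a x y : inner H (a *: x) y = a * inner H x y.
Proof. exact: (@linearl_subproof _ _ _ _ _ _ (inner H)). Qed.

Lemma innerZr a x y : inner H x (a *: y) = sconj a * inner H x y.
Proof. exact: (@linearr_subproof _ _ _ _ _ _ (inner H)). Qed.

Lemma ripC x y : rip x y = rip y x.
Proof. by rewrite /rip innerC sreal_conj. Qed.

Lemma ripDl x y z : rip (x + y) z = rip x z + rip y z.
Proof. by rewrite /rip linearDl srealD. Qed.

Lemma rip0l x : rip 0 x = 0.
Proof. by rewrite /rip linear0l sreal0. Qed.

Lemma ripNl x y : rip (- x) y = - rip x y.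
Proof. by rewrite /rip linearNl srealN. Qed.

Lemma ripZl (a : R) x y : rip (of_real k a *: x) y = a * rip x y.
Proof. by rewrite /rip innerZl sreal_of_realM. Qed.

Lemma ripBl x y z : rip (x - y) z = rip x z - rip y z.
Proof. by rewrite ripDl ripNl. Qed.

Lemma ripDr x y z : rip z (x + y) = rip z x + rip z y.
Proof. by rewrite !(ripC z) ripDl. Qed.

Lemma ripBr x y z : rip z (x - y) = rip z x - rip z y.
Proof. by rewrite !(ripC z) ripBl. Qed.

Lemma ripZr (a : R) x y : rip x (of_real k a *: y) = a * rip x y.
Proof. by rewrite !(ripC x) ripZl. Qed.

Lemma rip_norm x : rip x x = rnorm x ^+ 2.
Proof.
by rewrite /rip innerE -rnormE expr2 -of_realM of_realK -expr2.
Qed.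

Lemma rnormD_sqr x y :
  rnorm (x + y) ^+ 2 = rnorm x ^+ 2 + 2 * rip x y + rnorm y ^+ 2.
Proof. by rewrite -!rip_norm !ripDl !ripDr (ripC y x); ring. Qed.

Lemma rnormB_sqr x y :
  rnorm (x - y) ^+ 2 = rnorm x ^+ 2 - 2 * rip x y + rnorm y ^+ 2.
Proof. by rewrite -!rip_norm !ripBl !ripBr (ripC y x); ring. Qed.

Lemma rip_suml (I : Type) (r : seq I) (f : I -> H) y :
  rip (\sum_(i <- r) f i) y = \sum_(i <- r) rip (f i) y.
Proof.
by elim/big_rec2 : _ => [|i a b _ <-]; rewrite ?rip0l// ripDl.
Qed.

(** The square of the distance from [x] to its projection on the line of [y]
    is nonnegative. *)
Lemma rip_CauchySchwarz x y : `|rip x y| <= rnorm x * rnorm y.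
Proof.
have [y0|y0] := eqVneq (rnorm y) 0.
  by rewrite (rnorm_eq0 y0) ripC rip0l normr0 rnorm0 mulr0.
rewrite -(@ler_pXn2r _ 2)// ?nnegrE ?mulr_ge0 ?rnorm_ge0//.
rewrite real_normK ?num_real// exprMn.
have yp : 0 < rnorm y ^+ 2 by rewrite exprn_gt0// lt_def y0 rnorm_ge0.
have := sqr_ge0 (rnorm (x - of_real k (rip x y / rnorm y ^+ 2) *: y)).
rewrite rnormB_sqr ripZr rnorm_of_realZ exprMn real_normK ?num_real//.
move: (rip x y) (rnorm x ^+ 2) (rnorm y ^+ 2) yp => a b c c0.
have -> : b - 2 * (a / c * a) + (a / c) ^+ 2 * c = (b * c - a ^+ 2) / c.
  by field; rewrite gt_eqF.
by rewrite pmulr_lge0 ?invr_gt0// subr_ge0.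
Qed.

(** This carries identities of the real inner product over to the scalar one,
    for expressions that are linear over all scalars. *)
Lemma rip_inner x y x' y' :
  (forall a, rip (a *: x) y = rip (a *: x') y') -> inner H x y = inner H x' y'.
Proof.
by move=> xy; apply: sreal_mul_inj => a; rewrite -!innerZl; exact: xy.
Qed.

Lemma cvg_rip (T : Type) (F : set_system T) {FF : Filter F} (f : T -> H) l y :
  f x @[x --> F] --> l -> rip (f x) y @[x --> F] --> rip l y.
Proof.
move=> /cvg_rnormP fl; apply/cvgrPdist_lt => e e0.
have y0 : 0 < rnorm y + 1 by rewrite ltr_wpDl ?rnorm_ge0.
have := fl (e / (rnorm y + 1)) (divr_gt0 e0 y0); apply: filterS => x.
rewrite ltr_pdivlMr// -ripBl; apply: le_lt_trans.
rewrite (le_trans (rip_CauchySchwarz _ _))// ler_wpM2l ?rnorm_ge0//.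
by rewrite lerDl.
Qed.

End real_inner.

Lemma bounded_linear_rnorm (R : realType) (k : scalar_kind)
    (X Y : normedModType (scalar R k)) (f : X -> Y) (c : R) :
  linear f -> (forall x, rnorm (f x) <= c * rnorm x) ->
  f \in @bounded_linear_pred _ X Y.
Proof.
move=> lf fc; apply/asboolP; split=> //; exists (of_real k c) => x.
by rewrite -!rnormE -of_realM ler_of_real.
Qed.

Lemma operator_linear (K : numFieldType) (X Y : normedModType K)
  (T : 'B(X, Y)) : linear T.
Proof. by have /asboolP[] := bounded_operatorP T. Qed.

(** * Cauchy nets *)

Section completeness.
Variables (R : realType) (k : scalar_kind).
Variable X : completeNormedModType (scalar R k).

(** The Cauchy condition is asked in the form in which it is met: a single point
    that is eventually within [e], such as a finite partial sum. *)
Lemma rnorm_cauchy_cvg (T : Type) (F : set_system T) (FF : ProperFilter F)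
    (f : T -> X) :
  (forall e : R, 0 < e -> exists x, \forall t \near F, rnorm (x - f t) < e) ->
  exists l : X, f t @[t --> F] --> l.
Proof.
move=> fc; suff /cauchy_cvg : cauchy (f @ F) by move=> fl; exists (lim (f @ F)).
apply: cauchy_exP => z /gt0_of_real[e e0 ->].
have [x xe] := fc e e0; exists x.
by apply: filterS xe => t; rewrite -ball_normE /ball_ /= -rnormE ltr_of_real.
Qed.

End completeness.

(** * Orthogonal projections *)

Section orthogonal_projection.
Variables (R : realType) (k : scalar_kind) (H : hilbertType R k).
Variable U : closed_subspace H.
Implicit Types (x y u v : H).

Lemma subspaceB u v : subspace_set U u -> subspace_set U v ->
  subspace_set U (u - v).
Proof.
by move=> Uu Uv; apply: subspaceD => //; rewrite -scaleN1r; exact: subspaceZ.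
Qed.

(** The points of [U] that nearly minimize the distance to [x] form a Cauchy
    filter by the parallelogram identity; moving its limit inside [U] cannot
    decrease the distance to first order. *)
Lemma exists_orth_proj x : exists u, subspace_set U u /\
  forall v, subspace_set U v -> inner H (x - u) v = 0.
Proof.
pose dist2 u := rnorm (x - u) ^+ 2.
pose d := inf [set dist2 u | u in subspace_set U].
have d_le u : subspace_set U u -> d <= dist2 u.
  move=> Uu; apply: ge_inf; last by exists u.
  by exists 0 => _ [v _ <-]; exact: sqr_ge0.
pose near_min e := [set u | subspace_set U u /\ dist2 u < d + e].
have near_min_neq0 e : 0 < e -> near_min e !=set0.
  move=> e0; have [|_ [u Uu <-] ue] :=
      @inf_adherent _ [set dist2 u | u in subspace_set U] e e0.
    split; first by exists (dist2 0), 0 => //; exact: subspace0.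
    by exists 0 => _ [v _ <-]; exact: sqr_ge0.
  by exists u.
pose F := filter_from [set e | 0 < e] near_min.
have FF : ProperFilter F.
  apply: filter_from_proper => //; apply: filter_from_filter.
    by exists 1; exact: ltr01.
  move=> e f e0 f0; exists (Num.min e f); first by rewrite /= lt_min e0 f0.
  move=> u [Uu]; rewrite -ltrBlDl lt_min !ltrBlDl => /andP[ue uf].
  by split; split.
have [|l Fl] := @rnorm_cauchy_cvg _ _ H _ F FF id.
  move=> e e0; have e20 : 0 < (e / 2) ^+ 2 by rewrite exprn_gt0 ?divr_gt0.
  have [u [Uu ud]] := near_min_neq0 _ e20; exists u.
  exists ((e / 2) ^+ 2) => // v [Uv vd].
  rewrite -(@ltr_pXn2r _ 2)// ?nnegrE ?rnorm_ge0 ?ltW//.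
  have := d_le _ (subspaceZ (of_real k 2^-1) (subspaceD Uu Uv)).
  have -> : dist2 (of_real k 2^-1 *: (u + v)) =
      rnorm (of_real k 2^-1 *: ((x - u) + (x - v))) ^+ 2.
    by rewrite addrACA -opprD scalerBr scaler_half.
  have -> : u - v = (x - v) - (x - u) by rewrite opprB [RHS]addrC subrKA.
  move: ud vd; rewrite /dist2 rnorm_of_realZ [(`|_| * _) ^+ 2]exprMn.
  rewrite real_normK ?num_real// => ud vd mid.
  move: mid ud vd; rewrite (rnormD_sqr (x - u)) (rnormB_sqr (x - v)).
  by rewrite (ripC (x - v)); lra.
have Ul : subspace_set U l.
  apply: (closed_cvg _ (@subspace_closed _ _ _ U) _ _ Fl).
  by exists 1 => [|u []]; first exact: ltr01.
exists l; split=> // v Uv.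
(* Compare the distances from [x] to [u] and to [u + t w], for [u] near [l]. *)
have first_order w t : subspace_set U w ->
    2 * t * rip (x - l) w <= t ^+ 2 * rnorm w ^+ 2.
  move=> Uw.
  apply/ler_addgt0Pr => e e0.
  apply: (@cvgr_to_le _ F _ _ (fun u => 2 * t * rip (x - u) w)).
    apply: cvgM; first exact: cvg_cst.
    by apply: cvg_rip; apply: cvgB; [exact: cvg_cst|exact: Fl].
  exists e => // u [Uu ue].
  have := d_le _ (subspaceD Uu (subspaceZ (of_real k t) Uw)); rewrite /dist2.
  have -> : x - (u + of_real k t *: w) = x - u - of_real k t *: w.
    by rewrite opprD addrA.
  rewrite rnormB_sqr ripZr rnorm_of_realZ exprMn real_normK ?num_real//.
  move: ue; rewrite /dist2; lra.
have r0 w : subspace_set U w -> rip (x - l) w = 0.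
  move=> Uw; set n := rnorm w ^+ 2; set r := rip (x - l) w.
  have n0 : 0 < n + 1 by rewrite ltr_wpDl ?sqr_ge0.
  apply/eqP; rewrite -sqrf_eq0 eq_le sqr_ge0 andbT.
  (* At this [t] the first order term would win, were [r] nonzero. *)
  have := first_order w (r / (n + 1)) Uw; rewrite -/n -/r.
  have -> : 2 * (r / (n + 1)) * r = 2 * r ^+ 2 / (n + 1) by ring.
  have -> : (r / (n + 1)) ^+ 2 * n = r ^+ 2 * (n / (n + 1)) / (n + 1).
    by rewrite expr_div_n expr2 invfM; ring.
  rewrite ler_pM2r ?invr_gt0//; apply: contraTT; rewrite -!ltNge => r0.
  rewrite (@lt_trans _ _ (r ^+ 2))// ?gtr_pMr ?ltr_pdivrMr ?mul1r ?ltrDl//.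
  lra.
apply: etrans (linear0l (inner H) v); apply: rip_inner => a.
rewrite /rip innerZl -[a]sconjK -innerZr -/(rip _ _).
by rewrite r0 ?scaler0 ?linear0l ?sreal0//; exact: subspaceZ.
Qed.

Lemma orth_projP x : subspace_set U (orth_proj U x) /\
  forall v, subspace_set U v -> inner H (x - orth_proj U x) v = 0.
Proof.
exact: (xgetPex 0 (exists_orth_proj x)).
Qed.

Lemma orth_proj_uniq x u : subspace_set U u ->
  (forall v, subspace_set U v -> inner H (x - u) v = 0) -> orth_proj U x = u.
Proof.
move=> Uu xu; have [Up xp] := orth_projP x; apply/eqP; rewrite -subr_eq0.
set p := orth_proj U x in Up xp *; have Upu := subspaceB Up Uu.
apply/eqP/rnorm_eq0/eqP; rewrite -sqrf_eq0 -rip_norm /rip.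
have {1}-> : p - u = (x - u) - (x - p) by rewrite opprB [RHS]addrC subrKA.
by rewrite linearBl /= xu// xp// subrr sreal0.
Qed.

Lemma orth_proj_linear : linear (orth_proj U).
Proof.
move=> a x y; have [Ux xP] := orth_projP x; have [Uy yP] := orth_projP y.
apply: orth_proj_uniq => [|v Uv].
  by apply: subspaceD; first exact: subspaceZ.
rewrite opprD addrACA -scalerBr innerDl innerZl.
by rewrite xP// yP// mulr0 addr0.
Qed.

Lemma rip_orth_proj u y :
  subspace_set U u -> rip u y = rip u (orth_proj U y).
Proof.
move=> Uu; apply/eqP; rewrite -subr_eq0 -ripBr ripC /rip.
by rewrite (orth_projP y).2// sreal0.
Qed.

End orthogonal_projection.

(** * Finite and unconditional sums *)

#[local] Existing Instance totally_filter.

Section finite_sums.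
Variables (R : realType) (I : choiceType).
Implicit Types (a : I -> R) (A B : {fset I}).

Lemma partial_sumE (V : zmodType) (x : I -> V) A :
  partial_sum x A = \sum_(i <- A) x i.
Proof. by rewrite [RHS]big_seq_fsetE. Qed.

Lemma ge_esum_fset a A :
  ((\sum_(i <- A) a i)%:E <= \esum_(i in [set: I]) (a i)%:E)%E.
Proof.
apply: esum_ge; exists [set` A]; first by split.
by rewrite fsbig_finite//= set_fsetK sumEFin.
Qed.

Lemma lt_esum_fset a (r : R) : (r%:E < \esum_(i in [set: I]) (a i)%:E)%E ->
  exists A, r < \sum_(i <- A) a i.
Proof.
move=> /ereal_sup_gt[_ [X [finX _] <-]].
by rewrite fsbig_finite//= sumEFin lte_fin; exists (fset_set X).
Qed.

Lemma big_fset_incl_split (V : zmodType) (x : I -> V) A B : (A `<=` B)%fset ->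
  \sum_(i <- B) x i = \sum_(i <- A) x i + \sum_(i <- (B `\` A)%fset) x i.
Proof.
move=> AB; rewrite (big_fsetID _ (mem A) B) /=.
congr (_ + _); apply: eq_fbigl => i.
  by rewrite !inE /=; apply: andb_idl => /(fsubsetP AB).
by rewrite !inE andbC.
Qed.

Lemma near_totally A (P : {fset I} -> Prop) :
  (forall B, (A `<=` B)%fset -> P B) -> \forall B \near totally, P B.
Proof. by move=> AP; exists A. Qed.

End finite_sums.

(** * Synthesis, analysis and the frame operator *)

Section frame_operators.
Variables (R : realType) (k : scalar_kind) (H : hilbertType R k).
Variables (I : choiceType) (W : fusion_frame H I).
Implicit Types (x y : H) (f : l2_sum W) (A : {fset I}).

Let w := ff_weight W.
Let proj i := orth_proj (W i).

Variable (B : R).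
Hypothesis B_gt0 : 0 < B.
Hypothesis upper_bound : forall x,
  (\esum_(i in [set: I]) (w i ^+ 2 * rnorm (proj i x) ^+ 2)%:E <=
    (B * rnorm x ^+ 2)%:E)%E.

(** If [y] is the finite sum, then [B ||y||^2 = sum_A <B f_i, w_i p_i y>] with
    [p_i] the projections. Bound twice each term by
    [||B f_i||^2 + ||w_i p_i y||^2]: the frame bound lets half of the left-hand
    side absorb the sum of the [||w_i p_i y||^2]. *)
Lemma rnorm_synthesis_fset (f : I -> H) A :
  (forall i, subspace_set (W i) (f i)) ->
  rnorm (\sum_(i <- A) of_real k (w i) *: f i) ^+ 2 <=
    B * \sum_(i <- A) rnorm (f i) ^+ 2.
Proof.
move=> Wf; set y := \sum_(i <- A) _; rewrite -(ler_pM2l B_gt0).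
have yB : \sum_(i <- A) w i ^+ 2 * rnorm (proj i y) ^+ 2 <= B * rnorm y ^+ 2.
  rewrite -lee_fin; apply: le_trans; last exact: upper_bound.
  exact: (ge_esum_fset (fun i => w i ^+ 2 * rnorm (proj i y) ^+ 2)).
have yE : B * rnorm y ^+ 2 = \sum_(i <- A) B * (w i * rip (f i) (proj i y)).
  rewrite -mulr_sumr -rip_norm {1}/y rip_suml; congr (_ * _).
  by apply: eq_bigr => i _; rewrite ripZl (rip_orth_proj _ (Wf i)).
have : 2 * (B * rnorm y ^+ 2) <=
    B * (B * \sum_(i <- A) rnorm (f i) ^+ 2) + B * rnorm y ^+ 2.
  apply: le_trans (lerD (lexx _) yB); rewrite yE !mulr_sumr -big_split /=.
  apply: ler_sum => i _.
  (* The expansion bounds the doubled cross term of [B f_i] and [w_i p_i y]. *)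
  have := sqr_ge0 (rnorm (of_real k B *: f i - of_real k (w i) *: proj i y)).
  rewrite rnormB_sqr ripZl ripZr !rnorm_of_realZ !exprMn.
  by rewrite !real_normK ?num_real//; nra.
by lra.
Qed.

(** By [rnorm_synthesis_fset] for the differences [C `\` A], the finite sums
    inherit the Cauchy property of the sums of [||f_i||^2]. *)
Lemma synthesis_cvg_ex f : exists l : H,
  partial_sum (fun i => of_real k (w i) *: f i) A @[A --> totally] --> l.
Proof.
have /asboolP[Wf foo] := l2_funP f.
apply: rnorm_cauchy_cvg => e e0.
have eB0 : 0 < e ^+ 2 / B by rewrite divr_gt0// exprn_gt0.
have [|A Ae] := @lt_esum_fset _ _ (fun i => rnorm (f i) ^+ 2)
    (l2_norm f ^+ 2 - e ^+ 2 / B).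
  by rewrite [ltRHS]l2_normE lte_fin ltrBlDr ltrDl.
exists (\sum_(i <- A) of_real k (w i) *: f i).
apply: (@near_totally _ A) => C sAC; rewrite rnormB partial_sumE.
rewrite (big_fset_incl_split _ sAC) addrAC subrr add0r.
rewrite -(@ltr_pXn2r _ 2)// ?nnegrE ?rnorm_ge0 ?ltW//.
apply: le_lt_trans (rnorm_synthesis_fset _ Wf) _.
have := ge_esum_fset (fun i => rnorm (f i) ^+ 2) C.
rewrite [leRHS]l2_normE lee_fin (big_fset_incl_split _ sAC).
move: Ae; rewrite ltrBlDr -ltrBlDl ltr_pdivlMr// => Ae Cf.
apply: le_lt_trans Ae; rewrite mulrC ler_pM2r// lerBrDl//.
Qed.

(** [sum] is a limit by definition, so its existence identifies it. *)
Lemma synthesis_cvg f :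
  partial_sum (fun i => of_real k (w i) *: f i) A @[A --> totally] -->
  (sum (fun i => of_real k (w i) *: f i) : H).
Proof.
have [l fl] := synthesis_cvg_ex f.
by rewrite (_ : sum _ = l)//; apply: cvg_lim => //; exact: norm_hausdorff.
Qed.

Lemma rnorm_l2 f : rnorm f = l2_norm f.
Proof. exact: of_realK. Qed.

(** The synthesis map is linear and bounded, so that [synthesis W] is this map
    and not the default value of its definition; [analysisE] is the same for
    the analysis map. *)
Lemma synthesisE f : synthesis W f = sum (fun i => of_real k (w i) *: f i).
Proof.
rewrite /synthesis -[LHS]/((\val _) f) insubdK//.
apply: (@bounded_linear_rnorm _ _ _ _ _ (Num.sqrt B)) => [a g h|g].
  apply: (cvg_lim (@norm_hausdorff _ H)).
  rewrite (_ : partial_sum _ = fun A =>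
    a *: partial_sum (fun i => of_real k (w i) *: g i) A +
    partial_sum (fun i => of_real k (w i) *: h i) A); last first.
    apply/funext => A; rewrite !partial_sumE scaler_sumr -big_split /=.
    by apply: eq_bigr => i _; rewrite scalerDr !scalerA mulrC.
  by apply: cvgD; [apply: cvgZr|]; exact: synthesis_cvg.
have /asboolP[Wg _] := l2_funP g.
apply/ler_addgt0Pr => e e0.
have /cvg_rnormP /(_ e e0) [A _ /(_ A (fsubset_refl A)) /=] := @synthesis_cvg g.
rewrite partial_sumE => /ltW gA.
rewrite -[X in rnorm X](subrK (\sum_(i <- A) of_real k (w i) *: g i)).
rewrite (le_trans (ler_rnormD _ _))// [leRHS]addrC lerD//.
rewrite -(@ler_pXn2r _ 2)// ?nnegrE ?mulr_ge0 ?rnorm_ge0 ?sqrtr_ge0//.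
apply: le_trans (rnorm_synthesis_fset A Wg) _.
rewrite exprMn sqr_sqrtr ?(ltW B_gt0)// ler_pM2l// rnorm_l2 -lee_fin -l2_normE.
exact: (ge_esum_fset (fun i => rnorm (g i) ^+ 2)).
Qed.

Lemma analysis_l2 x :
  (fun i => of_real k (w i) *: proj i x) \in l2_pred W /\
  (sqnorm_sum (fun i => of_real k (w i) *: proj i x) <=
    (B * rnorm x ^+ 2)%:E)%E.
Proof.
have xB : (sqnorm_sum (fun i => of_real k (w i) *: proj i x) <=
    (B * rnorm x ^+ 2)%:E)%E.
  apply: le_trans (upper_bound x); apply: le_esum => i _.
  by rewrite rnorm_of_realZ exprMn real_normK ?num_real.
split=> //; apply/asboolP; split=> [i|]; last exact: le_lt_trans xB (ltry _).
by apply: subspaceZ; exact: (orth_projP _ _).1.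
Qed.

Lemma analysisE x i : analysis W x i = of_real k (w i) *: proj i x.
Proof.
pose F y : l2_sum W := insubd 0 (fun i => of_real k (w i) *: proj i y).
have FE y j : F y j = of_real k (w j) *: proj j y.
  by rewrite -[l2_fun (F y)]/(\val (F y)) insubdK//; exact: (analysis_l2 y).1.
rewrite -FE /analysis -[X in l2_fun X]/((\val _) x) insubdK//.
apply: (@bounded_linear_rnorm _ _ _ _ _ (Num.sqrt B)) => [a y z|y].
  apply/val_inj/funext => j; change (F (a *: y + z) j = a *: F y j + F z j).
  by rewrite !FE /proj orth_proj_linear scalerDr !scalerA mulrC.
change (rnorm (F y) <= Num.sqrt B * rnorm y).
rewrite -(@ler_pXn2r _ 2)// ?nnegrE ?mulr_ge0 ?rnorm_ge0 ?sqrtr_ge0//.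
rewrite exprMn sqr_sqrtr ?(ltW B_gt0)// rnorm_l2 -lee_fin -l2_normE.
apply: le_trans (analysis_l2 y).2; apply: le_esum => j _.
by rewrite FE.
Qed.

Let form_sum x y A : R := \sum_(i <- A) w i ^+ 2 * rip (proj i x) (proj i y).

(** At [y = x] these are the finite sums whose supremum the frame condition
    bounds; and they are symmetric in [x] and [y]. *)
Lemma frame_operator_cvg x y :
  form_sum x y @ totally --> rip (frame_operator W x) y.
Proof.
rewrite -[frame_operator W x]/(synthesis W (analysis W x)) synthesisE.
have -> : form_sum x y =
    fun A => rip (partial_sum (fun i => of_real k (w i) *: analysis W x i) A) y.
  apply/funext => A; rewrite partial_sumE rip_suml; apply: eq_bigr => i _.
  rewrite analysisE scalerA -of_realM ripZl -expr2 -rip_orth_proj//.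
  exact: (orth_projP _ _).1.
by apply: cvg_rip; exact: synthesis_cvg.
Qed.

Lemma frame_operator_sym x y :
  rip (frame_operator W x) y = rip x (frame_operator W y).
Proof.
rewrite (ripC x); apply: (cvg_unique (@Rhausdorff R) (@frame_operator_cvg x y)).
have -> : form_sum x y = form_sum y x.
  by apply/funext => A; apply: eq_bigr => i _; rewrite ripC.
exact: frame_operator_cvg.
Qed.

Lemma frame_operator_ge (a : R) x :
  ((a * rnorm x ^+ 2)%:E <=
   \esum_(i in [set: I]) (w i ^+ 2 * rnorm (proj i x) ^+ 2)%:E)%E ->
  a * rnorm x ^+ 2 <= rip (frame_operator W x) x.
Proof.
move=> ax; apply/ler_addgt0Pl => e e0; rewrite -lerBlDl.
have [|A Ae] := @lt_esum_fset _ _ (fun i => w i ^+ 2 * rnorm (proj i x) ^+ 2)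
    (a * rnorm x ^+ 2 - e).
  by apply: lt_le_trans ax; rewrite lte_fin ltrBlDr ltrDl.
apply: (cvgr_to_ge (@frame_operator_cvg x x)).
apply: (@near_totally _ A) => C sAC.
rewrite /form_sum (big_fset_incl_split _ sAC).
under eq_bigr do rewrite rip_norm.
rewrite (le_trans (ltW Ae))// lerDl sumr_ge0// => i _.
by rewrite rip_norm mulr_ge0 ?sqr_ge0.
Qed.

End frame_operators.

(** * The normed space of bounded operators *)

HB.instance Definition _ (K : numFieldType) (X Y : normedModType K)
  (T : 'B(X, Y)) := GRing.isLinear.Build K X Y *:%R T (operator_linear T).

Section operator_algebra.
Variables (R : realType) (k : scalar_kind).
Variables (X Y : normedModType (scalar R k)).

Lemma operatorB (S : 'B(X, Y)) x y : S (x - y) = S x - S y.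
Proof. exact: linearB. Qed.

Lemma operatorZ (S : 'B(X, Y)) a x : S (a *: x) = a *: S x.
Proof. exact: linearZ_LR. Qed.

Lemma rnorm_operator (S : 'B(X, Y)) x : rnorm (S x) <= rnorm S * rnorm x.
Proof. by rewrite [rnorm S]of_realK; exact: opnormP. Qed.

Lemma rnorm_operator_le (S : 'B(X, Y)) (c : R) : 0 <= c ->
  (forall x, rnorm (S x) <= c * rnorm x) -> rnorm S <= c.
Proof. by move=> c0 Sc; rewrite [rnorm S]of_realK; exact: opnorm_le. Qed.

Lemma operatorP (S T : 'B(X, Y)) : (forall x, S x = T x) -> S = T.
Proof. by move=> ST; apply/val_inj/funext. Qed.

Lemma cvg_operator_apply (I : Type) (F : set_system I) {FF : Filter F}
    (f : I -> 'B(X, Y)) (S : 'B(X, Y)) x :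
  f i @[i --> F] --> S -> f i x @[i --> F] --> S x.
Proof.
move=> /cvg_rnormP fS; apply/cvg_rnormP => e e0.
have x0 : 0 < rnorm x + 1 by rewrite ltr_wpDl ?rnorm_ge0.
have := fS (e / (rnorm x + 1)) (divr_gt0 e0 x0); apply: filterS => i.
rewrite ltr_pdivlMr//; apply: le_lt_trans.
rewrite (le_trans (rnorm_operator (S - f i) x))//.
by rewrite ler_wpM2l ?rnorm_ge0// lerDl.
Qed.

End operator_algebra.

Lemma rnorm_comp (R : realType) (k : scalar_kind)
    (X Y Z : normedModType (scalar R k)) (S : 'B(Y, Z)) (T : 'B(X, Y)) :
  rnorm (S \ob T) <= rnorm S * rnorm T.
Proof.
apply: rnorm_operator_le => [|x]; first by rewrite mulr_ge0 ?rnorm_ge0.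
rewrite (le_trans (rnorm_operator S (T x)))// -mulrA ler_wpM2l ?rnorm_ge0//.
exact: rnorm_operator.
Qed.

(** The pointwise limits of a Cauchy net of operators form an operator, and the
    Cauchy estimates, being uniform on bounded sets, survive in the limit. *)
Lemma operator_cauchy_cvg (R : realType) (k : scalar_kind)
    (X : normedModType (scalar R k)) (Y : completeNormedModType (scalar R k))
    (I : Type) (F : set_system I) (FF : ProperFilter F) (f : I -> 'B(X, Y)) :
  (forall e : R, 0 < e -> exists S, \forall i \near F, rnorm (S - f i) < e) ->
  exists S : 'B(X, Y), f i @[i --> F] --> S.
Proof.
move=> fc.
have lim_f x : exists y : Y, f i x @[i --> F] --> y.
  apply: rnorm_cauchy_cvg => e e0.
  have x0 : 0 < rnorm x + 1 by rewrite ltr_wpDl ?rnorm_ge0.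
  have [S fS] := fc (e / (rnorm x + 1)) (divr_gt0 e0 x0); exists (S x).
  apply: filterS fS => i; rewrite ltr_pdivlMr//; apply: le_lt_trans.
  rewrite (le_trans (rnorm_operator (S - f i) x))//.
  by rewrite ler_wpM2l ?rnorm_ge0// lerDl.
have [L fL] := choice lim_f.
have L_near e : 0 < e -> exists S : 'B(X, Y),
    (\forall i \near F, rnorm (S - f i) < e) /\
    forall x, rnorm (L x - S x) <= e * rnorm x.
  move=> e0; have [S fS] := fc e e0; exists S; split=> // x.
  apply/ler_addgt0Pr => d d0.
  have /cvg_rnormP /(_ d d0) Ld := fL x.
  have [i [/ltW Si /ltW Li]] := filter_ex (filterI fS Ld).
  rewrite (le_trans (ler_rnormB _ (f i x) _))// addrC lerD//.
  rewrite rnormB (le_trans (rnorm_operator (S - f i) x))//.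
  by rewrite ler_wpM2r ?rnorm_ge0.
have linL : linear L.
  move=> a x y; apply: (cvg_unique (@norm_hausdorff _ Y) (fL (a *: x + y))).
  rewrite (_ : (fun i => _) = fun i => a *: f i x + f i y); last first.
    by apply/funext => i; rewrite linearP.
  by apply: cvgD; [apply: cvgZr|].
have [S1 [_ LS1]] := L_near 1 ltr01.
have L_bounded : L \in @bounded_linear_pred _ X Y.
  apply: (@bounded_linear_rnorm _ _ _ _ _ (1 + rnorm S1)) => // x.
  rewrite -[L x](subrK (S1 x)) (le_trans (ler_rnormD _ _))// mulrDl lerD//.
  exact: rnorm_operator.
exists (BoundedOperator L_bounded); apply/cvg_rnormP => e e0.
have e3 : 0 < e / 3 by rewrite divr_gt0.
have [S [fS LS]] := L_near _ e3.
apply: filterS fS => i Si; rewrite (le_lt_trans (ler_rnormB _ S _))//.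
suff : rnorm (BoundedOperator L_bounded - S) <= e / 3 by lra.
by apply: rnorm_operator_le => [|x]; [exact: ltW|exact: LS].
Qed.

(** * Contractions *)

(** Completeness and closedness are taken as hypotheses on sequences, the form
    in which they are available for spaces of operators. *)
Section fixed_point.
Variables (R : realType) (k : scalar_kind) (X : normedModType (scalar R k)).
Hypothesis complete : forall u : nat -> X,
  (forall e : R, 0 < e -> exists x, \forall n \near \oo, rnorm (x - u n) < e) ->
  exists l : X, u @ \oo --> l.
Variables (D : set X) (phi : X -> X) (c : R) (x0 : X).
Hypotheses (D_closed : forall (u : nat -> X) (l : X),
    (forall n, D (u n)) -> u @ \oo --> l -> D l)
  (D_x0 : D x0) (D_phi : forall x, D x -> D (phi x)).
Hypotheses (c_ge0 : 0 <= c) (c_lt1 : c < 1).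
Hypothesis phi_contraction : forall x y, D x -> D y ->
  rnorm (phi x - phi y) <= c * rnorm (x - y).

Let residual x := rnorm (x - phi x).

Let D_iter n : D (iter n phi x0).
Proof. by elim: n => //= n; exact: D_phi. Qed.

(** A contraction bounds distances by residuals, which decay geometrically
    along the iteration. *)
Let dist_residual x y : D x -> D y ->
  (1 - c) * rnorm (x - y) <= residual x + residual y.
Proof.
move=> Dx Dy; rewrite mulrBl mul1r lerBlDr.
rewrite (le_trans (ler_rnormB _ (phi x) _))// -addrA lerD//.
rewrite (le_trans (ler_rnormB _ (phi y) _))// addrC lerD ?phi_contraction//.
by rewrite rnormB.
Qed.

Let residual_iter n : residual (iter n phi x0) <= c ^+ n * residual x0.
Proof.
elim: n => [|n IHn]; first by rewrite expr0 mul1r.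
have Dn := D_iter n; apply: le_trans (phi_contraction Dn (D_phi Dn)) _.
by rewrite exprS -mulrA ler_wpM2l.
Qed.

Let residual_small e : 0 < e ->
  \forall n \near \oo, residual (iter n phi x0) < e.
Proof.
move=> e0; have r0 : 0 < residual x0 + 1 by rewrite ltr_wpDl ?rnorm_ge0.
have /cvgrPdist_lt /(_ _ (divr_gt0 e0 r0)) : GRing.exp c @ \oo --> 0.
  by apply: cvg_expr; rewrite ger0_norm.
apply: filterS => n; rewrite sub0r normrN ger0_norm ?exprn_ge0//.
rewrite ltr_pdivlMr//; apply: le_lt_trans.
rewrite (le_trans (residual_iter n))// ler_wpM2l ?exprn_ge0//.
by rewrite lerDl.
Qed.

Lemma contraction_fixed_point : exists2 x, D x & phi x = x.
Proof.
have c1 : 0 < 1 - c by rewrite subr_gt0.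
have [|l ul] := complete (u := fun n => iter n phi x0).
  move=> e e0; have e2 : 0 < (1 - c) * (e / 2) by rewrite mulr_gt0 ?divr_gt0.
  have small := residual_small e2; have [m mr] := filter_ex small.
  exists (iter m phi x0); apply: filterS small => n nr.
  rewrite -(ltr_pM2l c1); apply: le_lt_trans (dist_residual _ _) _ => //.
  by lra.
have Dl : D l by apply: D_closed ul.
(* The residual of [l] is at most [2 ||l - u_n||] plus that of [u_n]. *)
exists l => //; apply/eqP; rewrite -subr_eq0; apply/eqP/rnorm_eq0/eqP.
rewrite eq_le rnorm_ge0 andbT; apply/ler_addgt0Pr => e e0; rewrite add0r.
have e3 : 0 < e / 3 by rewrite divr_gt0.
have /cvg_rnormP /(_ _ e3) un := ul.
have [n [ne re]] := filter_ex (filterI un (residual_small e3)).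
rewrite rnormB (le_trans (ler_rnormB _ (iter n phi x0) _))//.
have := ler_rnormB (iter n phi x0) (phi (iter n phi x0)) (phi l).
have := phi_contraction (D_iter n) Dl; rewrite rnormB in ne.
have := rnorm_ge0 (iter n phi x0 - l).
move: ne re; rewrite /residual [rnorm (l - _)]rnormB.
move: (rnorm _) (rnorm _) (rnorm _) (rnorm _) => p q r s; nra.
Qed.

End fixed_point.

(** * Square root and inverse of a coercive operator *)

Section coercive_operator.
Variables (R : realType) (k : scalar_kind) (H : hilbertType R k).
Implicit Types S T Y Z : 'B(H, H).

(** Symmetry for the real inner product; for operators that are linear over all
    scalars it gives self-adjointness, see [positive_of_symmetric]. *)
Definition symmetric_op S := forall x y, rip (S x) y = rip x (S y).

Lemma comp_opA S T Y : S \ob (T \ob Y) = S \ob T \ob Y.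
Proof. exact: operatorP. Qed.

Lemma comp_id_op S : bid H \ob S = S.
Proof. exact: operatorP. Qed.

Lemma comp_op_id S : S \ob bid H = S.
Proof. exact: operatorP. Qed.

Lemma comp_opBr S T Y : S \ob (T - Y) = (S \ob T) - (S \ob Y).
Proof. by apply: operatorP => x; exact: operatorB. Qed.

Lemma positive_of_symmetric S :
  symmetric_op S -> (forall x, 0 <= rip (S x) x) -> positive_op S.
Proof.
move=> Ssym S0; have sym x y : inner H (S x) y = inner H x (S y).
  by apply: rip_inner => a; rewrite -operatorZ Ssym.
split=> // x; apply: sreal_ge0; last exact: S0.
by rewrite -innerC sym.
Qed.

Section near_identity.
Variables (T : 'B(H, H)) (c : R).
Hypotheses (c_ge0 : 0 <= c) (c_lt1 : c < 1) (Tc : rnorm T <= c).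

(** Neumann's inverse of [1 - T], as the fixed point of [Y |-> 1 + T Y]. *)
Lemma exists_right_inverse : exists Y, (bid H - T) \ob Y = bid H.
Proof.
have contr Y Z : setT Y -> setT Z ->
    rnorm (bid H + (T \ob Y) - (bid H + (T \ob Z))) <= c * rnorm (Y - Z).
  move=> _ _; rewrite opprD addrACA subrr add0r -comp_opBr.
  by rewrite (le_trans (rnorm_comp _ _))// ler_wpM2r ?rnorm_ge0.
have [Y _ Yfix] := contraction_fixed_point (D := setT)
  (phi := fun Y => bid H + (T \ob Y)) (x0 := 0)
  (fun u => @operator_cauchy_cvg _ _ _ _ _ \oo eventually_filter u)
  (fun _ _ _ _ => I) I (fun _ _ => I) c_ge0 c_lt1 contr.
exists Y; apply: operatorP => x.
change (Y x - T (Y x) = x).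
by rewrite -{1}Yfix /= addrK.
Qed.

Hypothesis T_sym : symmetric_op T.

(** If [Y = (T + Y^2) / 2], then [(1 - Y)^2 = 1 - T]; and the right-hand side
    is a contraction of the closed ball of radius [c], which it maps into
    itself as [(c + c^2) / 2 <= c]. *)
Lemma exists_sqrt_correction : exists Y,
  [/\ rnorm Y <= c, symmetric_op Y & T + (Y \ob Y) = Y + Y].
Proof.
pose phi Y := of_real k 2^-1 *: (T + (Y \ob Y)).
pose D := [set Y | rnorm Y <= c /\ symmetric_op Y].
have half0 : `|2^-1| = 2^-1 :> R by rewrite ger0_norm.
have D_closed (u : nat -> 'B(H, H)) (l : 'B(H, H)) :
    (forall n, D (u n)) -> u @ \oo --> l -> D l.
  move=> Du ul; split.
    apply/ler_addgt0Pr => e e0; have /cvg_rnormP /(_ e e0) le := ul.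
    have [n /ltW ne] := filter_ex le.
    rewrite -[l](subrK (u n)) (le_trans (ler_rnormD _ _))// addrC lerD//.
    by have [] := Du n.
  move=> x y.
  have u_rip v w : rip (u n v) w @[n --> \oo] --> rip (l v) w.
    by apply: cvg_rip; exact: cvg_operator_apply.
  rewrite (ripC x); apply: (cvg_unique (@Rhausdorff R) (u_rip x y)).
  rewrite (_ : (fun n => rip (u n x) y) = fun n => rip (u n y) x).
    exact: u_rip.
  by apply/funext => n; rewrite (Du n).2 ripC.
have D0 : D 0.
  split; first by rewrite rnorm0.
  move=> x y; change (rip (0 : H) y = rip x (0 : H)).
  by rewrite (ripC x) !rip0l.
have D_phi Y : D Y -> D (phi Y).
  move=> [Yc Ysym]; split.
    rewrite rnorm_of_realZ half0 (le_trans (ler_wpM2l _ (ler_rnormD _ _)))//.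
    have : rnorm (Y \ob Y) <= c * c.
      by rewrite (le_trans (rnorm_comp _ _))// ler_pM ?rnorm_ge0.
    have : c * c <= c by rewrite ler_piMr// ltW.
    by move: Tc; lra.
  move=> x y; change (rip (of_real k 2^-1 *: (T x + Y (Y x))) y =
    rip x (of_real k 2^-1 *: (T y + Y (Y y)))).
  by rewrite ripZl ripZr ripDl ripDr T_sym !Ysym.
have contr Y Z : D Y -> D Z -> rnorm (phi Y - phi Z) <= c * rnorm (Y - Z).
  move=> [Yc _] [Zc _]; rewrite -scalerBr rnorm_of_realZ half0.
  have -> : T + (Y \ob Y) - (T + (Z \ob Z)) =
      (Y \ob (Y - Z)) + ((Y - Z) \ob Z).
    rewrite opprD addrACA subrr add0r comp_opBr; apply: operatorP => x.
    change (Y (Y x) - Z (Z x) = Y (Y x) - Y (Z x) + (Y (Z x) - Z (Z x))).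
    by rewrite subrKA.
  rewrite (le_trans (ler_wpM2l _ (ler_rnormD _ _)))//.
  have YZ := le_trans (rnorm_comp Y (Y - Z)) (ler_wpM2r (rnorm_ge0 _) Yc).
  have ZY := le_trans (rnorm_comp (Y - Z) Z) (ler_wpM2l (rnorm_ge0 _) Zc).
  by move: YZ ZY; rewrite [_ * c]mulrC; lra.
have [Y [Yc Ysym] Yfix] := contraction_fixed_point
  (fun u => @operator_cauchy_cvg _ _ _ _ _ \oo eventually_filter u)
  D_closed D0 D_phi c_ge0 c_lt1 contr.
exists Y; split=> //; by rewrite -[LHS]scaler_half scalerDr -/(phi Y) Yfix.
Qed.

End near_identity.

Variables (S : 'B(H, H)) (a : R).
Hypotheses (S_sym : symmetric_op S) (a_gt0 : 0 < a).
Hypothesis S_ge : forall x, a * rnorm x ^+ 2 <= rip (S x) x.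

Lemma coercive_inj x : S x = 0 -> x = 0.
Proof.
move=> Sx; have := S_ge x; rewrite Sx rip0l pmulr_rle0// => x0.
by apply/rnorm_eq0/eqP; rewrite -sqrf_eq0 eq_le x0 sqr_ge0.
Qed.

(** With [C >= ||S||], [||x - t S x||^2 <= (1 - 2 t a + t^2 C^2) ||x||^2];
    the factor is least for [t = a / C^2], where it is [1 - (a / C)^2 < 1]. *)
Lemma coercive_near_identity : exists t c : R, [/\ 0 < t, 0 <= c, c < 1 &
  rnorm (bid H - of_real k t *: S) <= c].
Proof.
pose C := rnorm S + a; have C0 : 0 < C by rewrite ltr_wpDl ?rnorm_ge0.
have aC : (a / C) ^+ 2 <= 1.
  rewrite expr_le1// ?divr_ge0 ?(ltW a_gt0) ?(ltW C0)// ?ler_pdivrMr// ?mul1r.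
  by rewrite /C lerDr rnorm_ge0.
have aC0 : 0 < (a / C) ^+ 2 by rewrite exprn_gt0 ?divr_gt0.
exists (a / C ^+ 2), (Num.sqrt (1 - (a / C) ^+ 2)); split.
- by rewrite divr_gt0 ?exprn_gt0.
- exact: sqrtr_ge0.
- by rewrite -[ltRHS]sqrtr1 ltr_sqrt// ltrBlDr ltrDl.
apply: rnorm_operator_le => [|x]; first exact: sqrtr_ge0.
change (rnorm (x - of_real k (a / C ^+ 2) *: S x) <=
  Num.sqrt (1 - (a / C) ^+ 2) * rnorm x).
rewrite -(@ler_pXn2r _ 2)// ?nnegrE ?mulr_ge0 ?rnorm_ge0 ?sqrtr_ge0//.
rewrite exprMn sqr_sqrtr ?subr_ge0// rnormB_sqr ripZr rnorm_of_realZ exprMn.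
rewrite real_normK ?num_real// ripC.
have SC : rnorm (S x) ^+ 2 <= C ^+ 2 * rnorm x ^+ 2.
  rewrite -exprMn ler_pXn2r// ?nnegrE ?mulr_ge0 ?rnorm_ge0 ?(ltW C0)//.
  rewrite (le_trans (rnorm_operator S x))// ler_wpM2r ?rnorm_ge0//.
  by rewrite /C lerDl ltW.
have := S_ge x; move: (rip _ _) (rnorm _ ^+ 2) (rnorm _ ^+ 2) SC => r p q pC ar.
have CN0 : C != 0 by rewrite gt_eqF.
have t0 : 0 <= a / C ^+ 2 by rewrite divr_ge0 ?sqr_ge0 ?ltW.
have := ler_wpM2l t0 ar; have := ler_wpM2l (sqr_ge0 (a / C ^+ 2)) pC.
have -> : (a / C ^+ 2) ^+ 2 * (C ^+ 2 * p) = (a / C) ^+ 2 * p by field.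
have -> : a / C ^+ 2 * (a * p) = (a / C) ^+ 2 * p by field.
lra.
Qed.

(** The right inverse is also a left inverse because [S] is injective. *)
Lemma coercive_inverse : exists J, J \ob S = bid H /\ S \ob J = bid H.
Proof.
have [t [c [t0 c0 c1 Tc]]] := coercive_near_identity.
have [Y YE] := exists_right_inverse c0 c1 Tc.
have SY x : S (of_real k t *: Y x) = x.
  have /(congr1 (fun Z : 'B(H, H) => Z x)) := YE.
  change (Y x - (Y x - of_real k t *: S (Y x)) = x ->
    S (of_real k t *: Y x) = x).
  by rewrite opprB addrC subrK operatorZ.
exists (of_real k t *: Y); split; apply: operatorP => x; last exact: SY.
apply/eqP; rewrite -subr_eq0; apply/eqP/coercive_inj.
by rewrite operatorB; apply/eqP; rewrite subr_eq0; apply/eqP; exact: SY.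
Qed.

(** The square root is [t^(-1/2) (1 - Y)], positive because [||Y|| < 1]. *)
Lemma coercive_sqrt : exists Q, positive_op Q /\ Q \ob Q = S.
Proof.
have [t [c [t0 c0 c1 Tc]]] := coercive_near_identity.
have [x y|Y [Yc Ysym YE]] := exists_sqrt_correction c0 c1 Tc.
  change (rip (x - of_real k t *: S x) y = rip x (y - of_real k t *: S y)).
  by rewrite ripBl ripBr ripZl ripZr S_sym.
(* [(1 - Y)^2 = t S], so the factor of [1 - Y] is [t^(-1/2)]. *)
pose s := (Num.sqrt t)^-1; have s0 : 0 < s by rewrite invr_gt0 sqrtr_gt0.
exists (of_real k s *: (bid H - Y)); split.
  apply: positive_of_symmetric => [x y|x].
    change (rip (of_real k s *: (x - Y x)) y =
      rip x (of_real k s *: (y - Y y))).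
    by rewrite ripZl ripZr ripBl ripBr Ysym.
  change (0 <= rip (of_real k s *: (x - Y x)) x).
  rewrite ripZl ripBl rip_norm mulr_ge0 ?(ltW s0)// subr_ge0.
  rewrite (le_trans (ler_norm _))// (le_trans (rip_CauchySchwarz _ _))//.
  rewrite expr2 ler_wpM2r ?rnorm_ge0// (le_trans (rnorm_operator Y x))//.
  by rewrite ler_piMl ?rnorm_ge0// (le_trans Yc)// ltW.
apply: operatorP => x.
have /(congr1 (fun Z : 'B(H, H) => Z x)) := YE.
change (x - of_real k t *: S x + Y (Y x) = Y x + Y x ->
  of_real k s *:
    (of_real k s *: (x - Y x) - Y (of_real k s *: (x - Y x))) = S x).
move=> Yx; rewrite operatorZ operatorB -scalerBr scalerA -of_realM.
have -> : x - Y x - (Y x - Y (Y x)) = of_real k t *: S x.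
  by rewrite opprB addrACA -opprD -Yx [x - _ + _]addrAC subKr.
rewrite scalerA -of_realM (_ : s * s * t = 1) ?of_real1 ?scale1r//.
rewrite -(sqr_sqrtr (ltW t0)) -expr2 -exprMn mulVf ?expr1n//.
by rewrite gt_eqF ?sqrtr_gt0.
Qed.

(** If [P P = S] and [J] inverts [S], then [J P = P J] inverts [P]. *)
Lemma inv_sqrt_sandwich :
  op_inv (op_sqrt S) \ob S \ob op_inv (op_sqrt S) = bid H.
Proof.
have [_ PP] : [set Q | positive_op Q /\ Q \ob Q = S] (op_sqrt S).
  exact: xgetPex coercive_sqrt.
set P := op_sqrt S in PP *; have [J [JS SJ]] := coercive_inverse.
have [QP PQ] : [set Q | Q \ob P = bid H /\ P \ob Q = bid H] (op_inv P).
  apply: xgetPex; exists (P \ob J); split; last by rewrite comp_opA PP.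
  have SP : S \ob P = P \ob S by rewrite -PP comp_opA.
  have -> : P \ob J = J \ob P.
    rewrite -[LHS]comp_id_op -[X in X \ob _]JS -comp_opA (comp_opA S) SP.
    by rewrite -(comp_opA P) SJ comp_op_id.
  by rewrite -comp_opA PP JS.
by rewrite -PP comp_opA QP comp_id_op PQ.
Qed.

End coercive_operator.

(** * The two tensor maps *)

Lemma sandwich_bounded_linear (R : realType) (k : scalar_kind)
    (X1 X2 X3 X4 : normedModType (scalar R k))
    (A : 'B(X3, X4)) (B : 'B(X1, X2)) :
  bounded_linear (fun O : 'B(X2, X3) => A \ob O \ob B).
Proof.
apply/asboolP; apply: (@bounded_linear_rnorm _ _ _ _ _ (rnorm A * rnorm B)).
  move=> a O P; apply: operatorP => x.
  change (A (a *: O (B x) + P (B x)) = a *: A (O (B x)) + A (P (B x))).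
  by rewrite operator_linear.
move=> O; rewrite (le_trans (rnorm_comp _ _))// mulrAC.
by rewrite ler_wpM2r ?rnorm_ge0// rnorm_comp.
Qed.

Lemma frame_inv_sqrt_sandwich (R : realType) (k : scalar_kind)
    (H : hilbertType R k) (I : choiceType) (W : fusion_frame H I) :
  frame_inv_sqrt W \ob frame_operator W \ob frame_inv_sqrt W = bid H.
Proof.
have [a [b [a0 ab bounds]]] := ff_bounds W.
have b0 : 0 < b by exact: lt_le_trans ab.
have upper x := (andP (bounds x)).2.
apply: (@inv_sqrt_sandwich _ _ _ _ a) => [x y||x]; first 2 last.
- by apply: (frame_operator_ge b0 upper); exact: (andP (bounds x)).1.
- exact: (frame_operator_sym b0 upper).
- exact: a0.
Qed.

Theorem theorem3p2 (R : realType) (k : scalar_kind) (H : hilbertType R k)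
    (I : choiceType) (W V : fusion_frame H I) :
  bounded_linear (M_tensor W V) /\
  bounded_linear (O_tensor W V) /\
  O_tensor W V \o M_tensor W V = idfun.
Proof.
split; [|split].
- have -> : M_tensor W V = fun O => (analysis W \ob frame_inv_sqrt W) \ob O \ob
      (frame_inv_sqrt V \ob synthesis V).
    by apply/funext => O; exact: operatorP.
  exact: sandwich_bounded_linear.
- have -> : O_tensor W V = fun M => (frame_inv_sqrt W \ob synthesis W) \ob M \ob
      (analysis V \ob frame_inv_sqrt V).
    by apply/funext => M; exact: operatorP.
  exact: sandwich_bounded_linear.
apply/funext => O; rewrite -[RHS]comp_op_id -[RHS]comp_id_op.
rewrite -{1}(frame_inv_sqrt_sandwich W) -(frame_inv_sqrt_sandwich V).
exact: operatorP.
Qed.
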